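(* Let $\alpha>0$, $\beta>0$, $t\ge0$. For every integer $n\ge0$, the diagonal recurrence coefficient $\alpha_n$ of the monic orthogonal polynomials for the weight $w(x)=e^{-t/x}x^\alpha(1-x)^\beta$ on $[0,1]$ satisfies $$(2n+2+\alpha+\beta)\,\alpha_n=2(r_n^*-r_n)+R_n-\beta-t,$$ where $R_n,r_n,r_n^*$ are defined in the context.
   Context: $P_n$ is the monic polynomial of degree $n$ with $\int_0^1P_mP_nw\,dx=h_n\delta_{m,n}$. The recurrence coefficients $\alpha_n,\beta_n$ (not to be confused with the parameters $\alpha,\beta$) are defined by $xP_n(x)=P_{n+1}(x)+\alpha_nP_n(x)+\beta_nP_{n-1}(x)$, with $P_0=1$, $\beta_0P_{-1}=0$. Auxiliary quantities: $R_n:=\frac{\beta}{h_n}\int_0^1[P_n(y)]^2w(y)\frac{dy}{1-y}$, $r_n^*:=\frac{t}{h_{n-1}}\int_0^1P_{n-1}(y)P_n(y)w(y)\frac{dy}{y}$, $r_n:=\frac{\beta}{h_{n-1}}\int_0^1P_{n-1}(y)P_n(y)w(y)\frac{dy}{1-y}$, with $r_0=r_0^*:=0$. *)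

(* Defs.v *)
From HB Require Import structures.
From mathcomp Require Import all_boot all_order all_algebra.
From mathcomp Require Import all_classical all_reals all_analysis.

Set Implicit Arguments.
Unset Strict Implicit.
Unset Printing Implicit Defensive.

Import Order.TTheory GRing.Theory Num.Theory.
Import numFieldNormedType.Exports.

Local Open Scope classical_set_scope.
Local Open Scope ring_scope.

(* [Rintegral] is 0 on a divergent nonnegative integrand; every integrand
   below is integrable when alpha, beta > 0 and t >= 0.  Since 0^-1 = 0, the
   singular factors 1 / y and 1 / (1 - y) are total; their values at y = 0 and
   y = 1 are irrelevant because points are Lebesgue-negligible. *)
Definition int01 (R : realType) (f : R -> R) : R :=
  \int[lebesgue_measure]_(x in `[0, 1]) f x.

Definition weight (R : realType) (alpha beta t : R) (x : R) : R :=
  expR (- (t / x)) * x `^ alpha * (1 - x) `^ beta.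

Definition monic_orthogonal (R : realType) (w : R -> R)
    (P : nat -> {poly R}) (h : nat -> R) : Prop :=
  (forall n, P n \is monic /\ size (P n) = n.+1) /\
  (forall m n,
     int01 (fun x => (P m).[x] * (P n).[x] * w x) = h n * (m == n)%:R).

(* The n = 0 case of the recurrence encodes beta_0 P_{-1} = 0, so b 0 is
   unconstrained. *)
Definition three_term_recurrence (R : realType)
    (P : nat -> {poly R}) (a b : nat -> R) : Prop :=
  P 0%N = 1 /\
  forall n, 'X * P n =
    P n.+1 + a n *: P n + (if n is k.+1 then b n *: P k else 0).

Definition aux_R (R : realType) (beta : R) (w : R -> R)
    (P : nat -> {poly R}) (h : nat -> R) (n : nat) : R :=
  beta / h n * int01 (fun y => (P n).[y] ^+ 2 * w y / (1 - y)).

Definition aux_rstar (R : realType) (t : R) (w : R -> R)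
    (P : nat -> {poly R}) (h : nat -> R) (n : nat) : R :=
  if n is k.+1 then
    t / h k * int01 (fun y => (P k).[y] * (P n).[y] * w y / y)
  else 0.

Definition aux_r (R : realType) (beta : R) (w : R -> R)
    (P : nat -> {poly R}) (h : nat -> R) (n : nat) : R :=
  if n is k.+1 then
    beta / h k * int01 (fun y => (P k).[y] * (P n).[y] * w y / (1 - y))
  else 0.

(* Main.v *)
(** Write [L p] for the integral of [p w] over [0, 1].  Since
    [w' / w = t / x^2 + alpha / x - beta / (1 - x)], integrating [(x q w)'] gives
    [(1 + alpha + beta) L q + L (x q') + t L (q / x) = beta L (q / (1 - x))] for
    every polynomial [q].  For [q = P_(n-1) P_n] orthogonality turns this into
    [p_n = r_n^* - r_n], where [p_n] is the subleading coefficient of [P_n]; for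
    [q = x P_n^2], using [a_n = p_n - p_(n+1)], it is the claimed identity with
    [p_n] in place of [r_n^* - r_n]. *)

From HB Require Import structures.
Require Import Defs.
From mathcomp Require Import all_boot all_order all_algebra.
From mathcomp Require Import all_classical all_reals all_analysis.
From mathcomp Require Import polyrcf measurable_realfun ring lra.

Import Order.TTheory GRing.Theory Num.Theory.
Import numFieldNormedType.Exports.
Local Open Scope classical_set_scope.
Local Open Scope ring_scope.

Set Implicit Arguments.
Unset Strict Implicit.
Unset Printing Implicit Defensive.

(** * Orthogonality with respect to an abstract linear functional *)

Section monic_orthogonal_functional.
Context (R : fieldType) (L : {scalar {poly R}}).
Variables (P : nat -> {poly R}) (h : nat -> R).
Hypothesis P_monic : forall n, P n \is monic /\ size (P n) = n.+1.
Hypothesis P_orth : forall m n, L (P m * P n) = h n * (m == n)%:R.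

Let lead_P n : (P n)`_n = 1.
Proof. by have [/monicP + sP] := P_monic n; rewrite lead_coefE sP. Qed.

Lemma size_sub_lead_monic n (p : {poly R}) : (size p <= n.+1)%N ->
  (size (p - p`_n *: P n)%R <= n)%N.
Proof.
move=> sp; apply/leq_sizeP => j; rewrite leq_eqVlt coefB coefZ =>
  /predU1P[<-|nj].
  by rewrite lead_P mulr1 subrr.
rewrite !(@nth_default _ _ _ j) ?mulr0 ?subrr// ?(P_monic n).2//.
exact: leq_trans sp nj.
Qed.

(** A polynomial of degree below [n] is a combination of [P 0], ..., [P n.-1], each of which is
    orthogonal to [P n]. *)
Lemma orthogonal_lower_size n (p : {poly R}) : (size p <= n)%N ->
  L (P n * p) = 0.
Proof.
(* The size bound [k] is decoupled from [n], so that the induction lowers [k] while [P n] stays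
   fixed. *)
suff : forall k, (k <= n)%N -> forall p : {poly R},
    (size p <= k)%N -> L (P n * p) = 0 by apply.
elim=> [_ q|k IH kn q sq].
  by rewrite leqn0 size_poly_eq0 => /eqP->; rewrite mulr0 linear0.
rewrite -(subrK (q`_k *: P k) q) mulrDr linearD /=.
rewrite IH ?(ltnW kn) ?size_sub_lead_monic// add0r -scalerAr linearZ /= P_orth.
by rewrite gtn_eqF// !mulr0.
Qed.

Lemma orthogonal_coef n (p : {poly R}) : (size p <= n.+1)%N ->
  L (P n * p) = p`_n * h n.
Proof.
move=> sp; rewrite -[in LHS](subrK (p`_n *: P n) p) mulrDr linearD /=.
rewrite orthogonal_lower_size ?size_sub_lead_monic// add0r.
by rewrite -scalerAr linearZ /= P_orth eqxx mulr1.
Qed.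

(** Removing the multiple of [P n.+1], which is orthogonal to [P n], reduces to the previous case;
    the removal shifts the coefficient of index [n] by the subleading coefficient of [P n.+1]. *)
Lemma orthogonal_coefS n (p : {poly R}) : (size p <= n.+2)%N ->
  L (P n * p) = (p`_n - p`_n.+1 * (P n.+1)`_n) * h n.
Proof.
move=> sp; rewrite -[in LHS](subrK (p`_n.+1 *: P n.+1) p) mulrDr linearD /=.
rewrite (orthogonal_coef (size_sub_lead_monic sp)) coefB coefZ.
rewrite -scalerAr linearZ /= P_orth.
by rewrite ltn_eqF// !mulr0 addr0.
Qed.

End monic_orthogonal_functional.

(** * The operator [x d/dx] and the algebra behind the recurrence coefficients *)

Lemma coefX_deriv (R : nzRingType) (p : {poly R}) i :
  ('X * p^`())`_i = p`_i *+ i.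
Proof. by rewrite coefXM coef_deriv; case: i => [|i]; rewrite ?mulr0n. Qed.

Lemma size_X_deriv (R : nzRingType) (p : {poly R}) :
  (size ('X * p^`())%R <= size p)%N.
Proof.
by apply/leq_sizeP => j pj; rewrite coefX_deriv nth_default ?mul0rn.
Qed.

(* [Lx p] and [L1 p] stand for the values of [L] at [p / x] and [p / (1 - x)]. *)
Section recurrence.
Context (R : fieldType) (L Lx L1 : {scalar {poly R}}) (alpha beta t : R).
Variables (P : nat -> {poly R}) (h : nat -> R) (a : nat -> R).
Hypothesis P_monic : forall n, P n \is monic /\ size (P n) = n.+1.
Hypothesis P_orth : forall m n, L (P m * P n) = h n * (m == n)%:R.
Hypothesis P_rec : forall n, ('X * P n - P n.+1)`_n = a n.
Hypothesis LxX : forall p, Lx ('X * p) = L p.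
Hypothesis L1X : forall p, L1 ('X * p) = L1 p - L p.
Hypothesis pearson : forall p, (1 + alpha + beta) * L p + L ('X * p^`()) +
  t * Lx p = beta * L1 p.

Let lead_P n : (P n)`_n = 1.
Proof. by have [/monicP + sP] := P_monic n; rewrite lead_coefE sP. Qed.

Let size_X_derivP n : (size ('X * (P n)^`())%R <= n.+1)%N.
Proof. by rewrite (leq_trans (size_X_deriv _))// (P_monic n).2. Qed.

Lemma subleading_coef k :
  (P k.+1)`_k * h k = t * Lx (P k * P k.+1) - beta * L1 (P k * P k.+1).
Proof.
have -> : t * Lx (P k * P k.+1) - beta * L1 (P k * P k.+1) =
    - ((1 + alpha + beta) * L (P k * P k.+1)
       + L ('X * (P k * P k.+1)^`())) by rewrite -pearson; ring.
have -> : 'X * (P k * P k.+1)^`() =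
    P k.+1 * ('X * (P k)^`()) + P k * ('X * (P k.+1)^`()).
  by rewrite derivM; ring.
rewrite linearD /= P_orth ltn_eqF// (orthogonal_lower_size P_monic P_orth)//.
rewrite (orthogonal_coefS P_monic P_orth)// !coefX_deriv lead_P.
rewrite mulr0n mulr0 -(mulr_natr _ k) -(mulr_natr _ k.+1) -natr1.
by ring.
Qed.

(* [('X * P n)`_n] is the subleading coefficient of [P n], with value [0] for
   [n = 0]. *)
Lemma recurrence_coef n :
  (2 * n%:R + 2 + alpha + beta) * a n * h n =
  2 * (('X * P n)`_n * h n) + beta * L1 (P n ^+ 2) - (beta + t) * h n.
Proof.
have e1 : L (P n * ('X * P n)) = a n * h n.
  rewrite (orthogonal_coefS P_monic P_orth); last first.
    by rewrite (leq_trans (size_polyMleq _ _))// size_polyX (P_monic n).2.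
  by rewrite -P_rec coefB [('X * P n)`_n.+1]coefXM /= lead_P mul1r.
(* With [s_n] the subleading coefficient of [P n], the value is [(n - 1) s_n - n s_(n+1)] times
   [h n], and [a n = s_n - s_(n+1)]. *)
have e2 : L (P n * ('X * ('X * (P n)^`()))) =
    (n%:R * a n - ('X * P n)`_n) * h n.
  rewrite (orthogonal_coefS P_monic P_orth); last first.
    by rewrite (leq_trans (size_polyMleq _ _))// size_polyX /= !ltnS.
  rewrite -P_rec coefB [in LHS]coefXM [('X * ('X * _))`_n.+1]coefXM /=.
  rewrite !coefX_deriv lead_P [in RHS]coefXM.
  case: n {e1} => [|n] /=; first by rewrite mulr0n; ring.
  by rewrite -(mulr_natr _ n) -(mulr_natr _ n.+1) -natr1; ring.
have e0 : L (P n ^+ 2) = h n by rewrite expr2 P_orth eqxx mulr1.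
(* The extra factor ['X] turns the [Lx] term into [L (P n ^+ 2) = h n], and the [L1] term into
   [L1 (P n ^+ 2) - h n]. *)
have := pearson ('X * P n ^+ 2).
have -> : 'X * ('X * P n ^+ 2)^`() =
    P n * ('X * P n) + 2 *: (P n * ('X * ('X * (P n)^`()))).
  by rewrite derivM derivX expr2 derivM scaler_nat; ring.
have -> : 'X * P n ^+ 2 = P n * ('X * P n) by ring.
rewrite linearD linearZ /= e1 e2.
have -> : P n * ('X * P n) = 'X * P n ^+ 2 by ring.
rewrite LxX L1X e0 => /eqP; rewrite -subr_eq0 => /eqP e.
by apply: subr0_eq; rewrite -[RHS]e; ring.
Qed.

End recurrence.

(** * The fundamental theorem of calculus on an open interval *)

Section FTC_open_interval.
Context {R : realType}.
Local Notation mu := (@lebesgue_measure R).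
Variables (f F : R -> R) (a b la lb : R).
Hypothesis ab : a < b.
Hypothesis dF : {in `]a, b[, forall x : R, is_derive x 1 F (f x)}.
Hypothesis cf : {in `]a, b[, continuous f}.
Hypothesis Fa : F x @[x --> a^'+] --> la.
Hypothesis Fb : F x @[x --> b^'-] --> lb.

(* [f] may be unbounded near [a] and [b], so the integral is exhausted by the
   compact intervals [K n]. *)
Let d n : R := (b - a) / n.+3%:R.

Let d_gt0 n : 0 < d n.
Proof. by rewrite divr_gt0 ?subr_gt0. Qed.

(** The offset 3 in [d] keeps at least a third of the interval, so [K n] is nondegenerate from
    [n = 0] on. *)
Let d_lt n : a + d n < b - d n.
Proof.
have : d n * 3 <= b - a.
  by rewrite /d mulrAC ler_pdivrMr// ler_pM2l ?subr_gt0// ler_nat.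
by have := d_gt0 n; lra.
Qed.

Let d_cvg : d n @[n --> \oo] --> 0.
Proof.
have -> : 0 = (b - a) * 0 by rewrite mulr0.
apply: cvgM; first exact: cvg_cst.
have := @cvg_harmonic R; rewrite -(cvg_shiftn 2) /harmonic /=.
by under eq_cvg do rewrite addn2.
Qed.

Let K n := `[a + d n, b - d n]%classic.

Let K_sub n : K n `<=` `]a, b[.
Proof.
by move=> x; rewrite /K /= !in_itv /=; have := d_gt0 n; lra.
Qed.

Let K_nondecreasing : nondecreasing_seq K.
Proof.
move=> m n mn; apply/subsetPset => x; rewrite /K /= !in_itv /=.
have : d n <= d m by rewrite ler_pM2l ?subr_gt0// lef_pV2 ?posrE// ler_nat !ltnS.
by lra.
Qed.

Let K_bigcup : \bigcup_n K n = `]a, b[%classic.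
Proof.
apply/seteqP; split => [x [n _ /K_sub//]|x /= /[!in_itv]/= /andP[ax xb]].
near \oo => n; exists n => //; rewrite /K /= in_itv /=.
have : d n < x - a by near: n; apply: (cvgr_lt _ d_cvg); rewrite subr_gt0.
have : d n < b - x by near: n; apply: (cvgr_lt _ d_cvg); rewrite subr_gt0.
by lra.
Unshelve. all: by end_near. Qed.

Let int_K n : (\int[mu]_(x in K n) (f x)%:E)%E = (F (b - d n) - F (a + d n))%:E.
Proof.
have dFK x : x \in `[a + d n, b - d n] -> derivable F x 1.
  by move=> /K_sub/dF[].
rewrite /K (continuous_FTC2 (d_lt n) _ _ _ (F := F))//.
- move=> /=; apply: continuous_in_subspaceT => x /[!inE] /K_sub; exact: cf.
- have /(continuous_within_itvP _ (d_lt n))[_ ? ?] :=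
    derivable_within_continuous dFK.
  by split => // x /subset_itv_oo_cc; exact: dFK.
- move=> x /subset_itv_oo_cc/K_sub/dF[_ <-]; exact: derive1E.
Qed.

Let int_K_cvg : (\int[mu]_(x in K n) (f x)%:E)%E @[n --> \oo] --> (lb - la)%:E.
Proof.
under eq_cvg do rewrite int_K.
apply: cvg_EFin; first exact: nearW.
apply: cvgB.
  move/cvg_at_leftP : Fb; apply; split => [n|]; first by rewrite ltrBlDr ltrDl.
  by rewrite -[X in _ --> X]subr0; apply: cvgB => //; exact: cvg_cst.
move/cvg_at_rightP : Fa; apply; split => [n|]; first by rewrite ltrDl.
by rewrite -[X in _ --> X]addr0; apply: cvgD => //; exact: cvg_cst.
Qed.

Let mf : measurable_fun `]a, b[ f.
Proof. by apply: open_continuous_measurable_fun => // x /[!inE] /cf. Qed.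

(** Monotone convergence along [K n]. Finiteness of the integral comes out as a conclusion, which is
    how the power functions below are shown to be integrable. *)
Lemma ge0_integral_derive_oo : {in `]a, b[, forall x : R, 0 <= f x} ->
  (\int[mu]_(x in `]a, b[) (f x)%:E)%E = (lb - la)%:E.
Proof.
move=> f0; apply: (cvg_unique _ _ int_K_cvg) => //.
rewrite -K_bigcup; apply: ge0_nondecreasing_set_cvg_integral => //.
- by move=> n; exact: measurable_itv.
- move=> n; apply/measurable_EFinP.
  by apply: measurable_funS mf => //; exact: K_sub.
- by move=> n x /K_sub/f0; rewrite lee_fin.
Qed.

(** For integrands of varying sign: dominated convergence along [K n], with the absolute value of
    [f] as dominating function. *)
Lemma integral_derive_oo : mu.-integrable `]a, b[ (EFin \o f) ->
  (\int[mu]_(x in `]a, b[) (f x)%:E)%E = (lb - la)%:E.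
Proof.
move=> intf.
suff : (\int[mu]_(x in K n) (f x)%:E)%E @[n --> \oo] -->
    (\int[mu]_(x in `]a, b[) (f x)%:E)%E.
  by move/cvg_unique => /(_ (@ereal_hausdorff R) _ int_K_cvg).
have KE n : (\int[mu]_(x in K n) (f x)%:E)%E =
    (\int[mu]_(x in `]a, b[) ((EFin \o f) \_ (K n)) x)%E.
  by rewrite -integral_mkcondr setIidr//; exact: K_sub.
under eq_cvg do rewrite KE.
have mfE : measurable_fun `]a, b[ (EFin \o f) by exact/measurable_EFinP.
have mfK n : measurable_fun `]a, b[ ((EFin \o f) \_ (K n)).
  apply/measurable_restrict => //; first exact: measurable_itv.
  by apply: measurable_funS mfE => //; exact: subIsetl.
(* Each point enters some [K m] and stays in all later ones, so the restricted values are eventually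
   constant. *)
have fK_cvg : {ae mu, forall x, `]a, b[%classic x ->
    ((EFin \o f) \_ (K n)) x @[n --> \oo] --> (EFin \o f) x}.
  apply: aeW => x; rewrite -K_bigcup => -[m _ Kx].
  apply: cvg_near_cst; exists m => // n /= mn.
  rewrite patchE mem_set//.
  by move: Kx; apply/subsetPset/K_nondecreasing.
have fK_le : {ae mu, forall x n, `]a, b[%classic x ->
    (`|((EFin \o f) \_ (K n)) x| <= (abse \o (EFin \o f)) x)%E}.
  apply: aeW => x n _; rewrite patchE.
  by case: ifP => //= _; rewrite normr0 lee_fin.
by have [] := dominated_convergence (mu := mu) (measurable_itv _) mfK mfE fK_cvg
  (integrable_abse intf) fK_le.
Qed.

End FTC_open_interval.

(** * Integrability of endpoint powers and of polynomial multiples *)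

Section power_integrable.
Context {R : realType}.
Local Notation mu := (@lebesgue_measure R).
Implicit Types (x r : R) (p : {poly R}) (g : R -> R).

Lemma is_derive1_continuous (f : R -> R) x (l : R) :
  is_derive x 1 f l -> {for x, continuous f}.
Proof. by move=> [df _]; exact/differentiable_continuous/derivable1_diffP. Qed.

Lemma is_derive_onem_powR x r : x < 1 ->
  is_derive x 1 (fun y : R => (1 - y) `^ r) (- (r * (1 - x) `^ (r - 1))).
Proof.
move=> x1; have x1' : 0 < 1 - x by rewrite subr_gt0.
have d1 : is_derive x 1 (fun y : R => 1 - y) (-1).
  by apply: is_derive_eq; rewrite add0r mul1r.
have := @is_derive1_comp _ (fun y : R => y `^ r) (fun y : R => 1 - y) x _ _
  (is_derive1_powR r x1') d1.
by rewrite mulrN1.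
Qed.

Lemma onem_powR_cvg0 r : 0 < r -> (1 - x) `^ r @[x --> 1^'-] --> 0.
Proof.
move=> r0.
apply/cvg_at_leftP => u [u1 u_cvg].
move/cvg_at_rightP : (powR_cvg0 r0) => /(_ (fun n => 1 - u n)); apply.
split=> [n|]; first by rewrite subr_gt0.
by rewrite -(subrr 1); apply: cvgB => //; exact: cvg_cst.
Qed.

Lemma integrable_powRB1 r : 0 < r ->
  mu.-integrable `]0, 1[ (fun x => (x `^ (r - 1))%:E).
Proof.
move=> r0; apply/integrableP; split.
  apply/measurable_EFinP/measurable_funTS; exact: measurable_powR.
under eq_integral do rewrite /= ger0_norm ?powR_ge0//.
have c1 : x `^ r @[x --> 1^'-] --> 1 `^ r.
  apply: cvg_at_left_filter.
  exact: is_derive1_continuous (is_derive1_powR r ltr01).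
rewrite (@ge0_integral_derive_oo R (fun x => x `^ (r - 1))
  (fun x => r^-1 * x `^ r) 0 1 (r^-1 * 0) (r^-1 * 1 `^ r)) ?ltry//.
- move=> x /[!in_itv]/= /andP[x0 _].
  have dx := is_derive1_powR r x0.
  by apply: is_derive_eq; rewrite /GRing.scale/= mulKf ?gt_eqF.
- move=> x /[!in_itv]/= /andP[x0 _].
  exact: is_derive1_continuous (is_derive1_powR (r - 1) x0).
- by apply: cvgMr; exact: powR_cvg0.
- exact: cvgMr.
- by move=> x _; exact: powR_ge0.
Qed.

Lemma integrable_onem_powRB1 r : 0 < r ->
  mu.-integrable `]0, 1[ (fun x => ((1 - x) `^ (r - 1))%:E).
Proof.
move=> r0; have d r' x : x \in `]0, 1[ -> is_derive x 1
    (fun y : R => (1 - y) `^ r') (- (r' * (1 - x) `^ (r' - 1))).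
  by move=> x01; apply: is_derive_onem_powR; rewrite (itvP x01).
apply/integrableP; split.
  apply/measurable_EFinP; apply: open_continuous_measurable_fun => // x.
  rewrite inE => x01.
  exact: is_derive1_continuous (d (r - 1) x x01).
under eq_integral do rewrite /= ger0_norm ?powR_ge0//.
have c0 : (1 - x) `^ r @[x --> 0^'+] --> (1 - 0) `^ r.
  apply: cvg_at_right_filter.
  exact: is_derive1_continuous (is_derive_onem_powR r ltr01).
rewrite (@ge0_integral_derive_oo R (fun x => (1 - x) `^ (r - 1))
  (fun x => - r^-1 * (1 - x) `^ r) 0 1
  (- r^-1 * (1 - 0) `^ r) (- r^-1 * 0)) ?ltry//.
- move=> x x01; have dx := d r x x01.
  by apply: is_derive_eq; rewrite /GRing.scale/= mulrNN mulKf ?gt_eqF.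
- move=> x x01; exact: is_derive1_continuous (d (r - 1) x x01).
- exact: cvgMr.
- by apply: cvgMr; exact: onem_powR_cvg0.
- by move=> x _; exact: powR_ge0.
Qed.

(** On the unit interval a polynomial is bounded by the sum of the absolute values of its
    coefficients. *)
Lemma integrable_horner p g : mu.-integrable `]0, 1[ (EFin \o g) ->
  mu.-integrable `]0, 1[ (EFin \o (fun x => p.[x] * g x)).
Proof.
move=> gi; apply: (integrableMr _ _ _ gi) => //.
  apply: open_continuous_measurable_fun => // x _.
  exact: is_derive1_continuous (is_derive_poly p x).
exists (\sum_(i < size p) `|p`_i|); split; first exact: num_real.
move=> M ltM x /= /[!in_itv]/= /andP[x0 x1].
rewrite (le_trans _ (ltW ltM))// horner_coef (le_trans (ler_norm_sum _ _ _))//.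
apply: ler_sum => i _; rewrite normrM ler_piMr// normrX exprn_ile1//.
by rewrite ger0_norm ltW.
Qed.

End power_integrable.

(** * Moment functionals of a density on the unit interval *)

Section moment.
Context {R : realType}.
Local Notation mu := (@lebesgue_measure R).
Implicit Types (x : R) (p q : {poly R}) (g : R -> R).

(** The interval is open because the densities [w / x] and [w / (1 - x)] may be singular at the
    endpoints. *)
Definition moment g p : R := \int[mu]_(x in `]0, 1[) (p.[x] * g x).

Lemma moment_is_scalar g : mu.-integrable `]0, 1[ (EFin \o g) ->
  scalar (moment g).
Proof.
move=> gi c p q; rewrite /moment.
under eq_Rintegral do rewrite hornerD hornerZ mulrDl -mulrA.
rewrite RintegralD//; last 2 first.
- by have := integrableZl (mu := mu) (measurable_itv _) c
    (integrable_horner p gi).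
- exact: integrable_horner gi.
by rewrite RintegralZl//; exact: integrable_horner gi.
Qed.

(** Bundling the linearity proof lets [moment g] instantiate [L], [Lx] and [L1] of the algebraic
    part. *)
Definition moment_functional g (gi : mu.-integrable `]0, 1[ (EFin \o g)) :
    {scalar {poly R}} :=
  HB.pack (moment g)
    (GRing.isLinear.Build R {poly R} R *%R (moment g) (moment_is_scalar gi)).

(** The endpoints form a null set. The pointwise hypothesis absorbs the different ways in which the
    integrands are bracketed. *)
Lemma int01_moment g p (f : R -> R) (gi : mu.-integrable `]0, 1[ (EFin \o g)) :
  (forall x, f x = p.[x] * g x) -> int01 f = moment_functional gi p.
Proof.
move=> fE; rewrite /int01 (funext fE) /Rintegral integral_itv_bndoo//.
exact: measurable_int (integrable_horner p gi).
Qed.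

(** If the integral of the nonnegative function [p ^+ 2 * g] vanished, the unit interval would be
    covered by a null set and the finitely many roots of [p]. This provides [h n != 0]. *)
Lemma moment_neq0 g p : {in `]0, 1[, forall x, 0 < g x} ->
  mu.-integrable `]0, 1[ (EFin \o g) -> p != 0 -> moment g (p ^+ 2) != 0.
Proof.
move=> g0 gi p0; apply/eqP => mp0.
have pgi := integrable_horner (p ^+ 2) gi.
have : (\int[mu]_(x in `]0%R, 1%R[) `|((p ^+ 2).[x] * g x)%:E| = 0)%E.
  have <- : (moment g (p ^+ 2))%:E = 0%E by rewrite mp0.
  rewrite /moment /Rintegral fineK; last first.
    exact: integrable_fin_num pgi.
  apply: eq_integral => x /[!inE] x01.
  have px0 : 0 <= (p ^+ 2).[x] by rewrite horner_exp sqr_ge0.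
  by rewrite gee0_abs// lee_fin mulr_ge0// ltW ?g0.
move/ae_eq_integral_abs => -[//||N [mN N0 subN]].
  exact: measurable_int pgi.
have rootsN : `]0, 1[%classic `<=` N `|` [set` roots p 0 1].
  move=> x x01; have [rx|rx] := boolP (root p x).
    by right; rewrite /= in_roots rx x01.
  left; apply: subN => /= /(_ x01) [] /eqP; rewrite horner_exp mulf_eq0.
  by rewrite sqrf_eq0 -rootE (negbTE rx) /= gt_eqF ?g0.
have mroots : mu [set` roots p 0 1] = 0%E.
  by apply/countable_lebesgue_measure0/finite_set_countable/finite_seq.
have mrt : measurable [set` roots p 0 1].
  by apply/countable_measurable/finite_set_countable/finite_seq.
have NR0 : mu (N `|` [set` roots p 0 1]) = 0%E by rewrite null_set_setU.
have : mu `]0, 1[ = 0%E := subset_measure0 (mu := mu) (measurable_itv _)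
  (measurableU _ _ mN mrt) rootsN NR0.
rewrite lebesgue_measure_itv /= lte_fin ltr01 -EFinB subr0 => -[] /eqP.
by rewrite oner_eq0.
Qed.

End moment.

(** * The weight: bounds, integrability and the Pearson identity *)

Section weight.
Context {R : realType}.
Local Notation mu := (@lebesgue_measure R).
Variables (alpha beta t : R).
Hypotheses (alpha_gt0 : 0 < alpha) (beta_gt0 : 0 < beta) (t_ge0 : 0 <= t).
Local Notation w := (weight alpha beta t).
Implicit Types (x : R) (p : {poly R}) (g : R -> R).

Let itv01 x : x \in `]0, 1[ -> 0 < x /\ 0 < 1 - x.
Proof. by rewrite in_itv /= subr_gt0 => /andP[]. Qed.

Lemma weight_gt0 x : x \in `]0, 1[ -> 0 < w x.
Proof.
by move=> /itv01[x0 x1]; rewrite /weight !mulr_gt0 ?expR_gt0 ?powR_gt0.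
Qed.

Let expR_le1 x : x \in `]0, 1[ -> expR (- (t / x)) <= 1.
Proof.
by move=> /itv01[x0 _]; rewrite -expR0 ler_expR oppr_le0 divr_ge0 // ltW.
Qed.

Let powR_le1 x r : 0 < r -> 0 <= x <= 1 -> x `^ r <= 1.
Proof.
move=> r0 /andP[x0 x1]; have <- : 1 `^ r = 1 :> R by rewrite powR1.
by apply: ge0_ler_powR; rewrite ?nnegrE // ltW.
Qed.

(** The exponential and the power of [1 - x] are at most 1; the factor kept is the one that controls
    [w] near 0. *)
Lemma weight_le_powR x : x \in `]0, 1[ -> w x <= x `^ alpha.
Proof.
move=> x01; have [x0 x1] := itv01 x01; rewrite /weight mulrAC.
rewrite ler_piMl ?powR_ge0//.
by rewrite mulr_ile1 ?expR_ge0 ?powR_ge0 ?expR_le1 ?powR_le1//; lra.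
Qed.

Lemma weight_le_powR_onem x : x \in `]0, 1[ -> w x <= (1 - x) `^ beta.
Proof.
move=> x01; have [x0 x1] := itv01 x01; rewrite /weight.
rewrite ler_piMl ?powR_ge0//.
by rewrite mulr_ile1 ?expR_ge0 ?powR_ge0 ?expR_le1 ?powR_le1//; lra.
Qed.

Let powRB1 x r : 0 < x -> x `^ (r - 1) = x `^ r / x.
Proof. by move=> x0; rewrite powRB ?powRr1 ?ltW ?(gt_eqF x0) ?implybT. Qed.

Lemma is_derive_weight x : x \in `]0, 1[ ->
  is_derive x 1 w (w x * (t / x ^+ 2 + alpha / x - beta / (1 - x))).
Proof.
move=> x01; have [x0 x1] := itv01 x01.
have dV : is_derive x 1 (fun y : R => - (t / y)) (t / x ^+ 2).
  have dV := @is_deriveV R id x 1 1 (lt0r_neq0 x0) _.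
  apply: is_derive_eq.
  by rewrite /GRing.scale /=; field; rewrite gt_eqF.
have dexp := @is_derive1_comp _ expR _ x _ _ (is_derive_expR _) dV.
have dpow := is_derive1_powR alpha x0.
have x1' : x < 1 by rewrite -subr_gt0.
have dw : is_derive x 1 w _ :=
  is_deriveM (is_deriveM dexp dpow) (is_derive_onem_powR beta x1').
apply: (is_derive_eq dw).
rewrite /weight /GRing.scale /= !powRB1// mulrfctE /=.
by field; rewrite !gt_eqF.
Qed.

Let continuous_weight x : x \in `]0, 1[ -> {for x, continuous w}.
Proof. by move=> x01; exact: is_derive1_continuous (is_derive_weight x01). Qed.

Let continuous_inv x : x \in `]0, 1[ -> {for x, continuous (fun y : R => y^-1)}.
Proof. by move=> /itv01[x0 _]; apply: inv_continuous; rewrite gt_eqF. Qed.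

Let continuous_onem_inv x : x \in `]0, 1[ ->
  {for x, continuous (fun y : R => (1 - y)^-1)}.
Proof.
move=> /itv01[_ x1]; apply: cvgV; first by rewrite gt_eqF.
by apply: cvgB; [exact: cvg_cst|exact: cvg_id].
Qed.

Let continuous_weight_div x : x \in `]0, 1[ ->
  {for x, continuous (fun y => w y / y)}.
Proof.
by move=> x01; apply: cvgM; [exact: continuous_weight|exact: continuous_inv].
Qed.

Let continuous_weight_div_onem x : x \in `]0, 1[ ->
  {for x, continuous (fun y => w y / (1 - y))}.
Proof.
move=> x01; apply: cvgM; first exact: continuous_weight.
exact: continuous_onem_inv.
Qed.

Lemma integrable_weight_div : mu.-integrable `]0, 1[ (fun x => (w x / x)%:E).
Proof.
apply: le_integrable (integrable_powRB1 alpha_gt0) => //.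
  apply/measurable_EFinP; apply: open_continuous_measurable_fun => //.
  by move=> x /[!inE]; exact: continuous_weight_div.
move=> x /= x01; have [x0 _] := itv01 x01.
rewrite lee_fin !ger0_norm ?powR_ge0 ?divr_ge0 ?(ltW x0)//;
  last exact/ltW/weight_gt0.
by rewrite powRB1// ler_pM2r ?invr_gt0// weight_le_powR.
Qed.

Lemma integrable_weight_div_onem :
  mu.-integrable `]0, 1[ (fun x => (w x / (1 - x))%:E).
Proof.
apply: le_integrable (integrable_onem_powRB1 beta_gt0) => //.
  apply/measurable_EFinP; apply: open_continuous_measurable_fun => //.
  by move=> x /[!inE]; exact: continuous_weight_div_onem.
move=> x /= x01; have [_ x1] := itv01 x01.
rewrite lee_fin !ger0_norm ?powR_ge0 ?divr_ge0 ?(ltW x1)//;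
  last exact/ltW/weight_gt0.
by rewrite powRB1// ler_pM2r ?invr_gt0// weight_le_powR_onem.
Qed.

Lemma integrable_weight : mu.-integrable `]0, 1[ (fun x => (w x)%:E).
Proof.
apply: eq_integrable (integrable_horner 'X integrable_weight_div) => //.
move=> x /[!inE] x01; have [x0 _] := itv01 x01.
by rewrite /= hornerX mulrCA divff ?mulr1// gt_eqF.
Qed.

Let horner_weight_cvg0_left p : p.[x] * w x @[x --> 1^'-] --> 0.
Proof.
rewrite -(mulr0 p.[1]); apply: cvgM.
  apply: cvg_at_left_filter.
  exact: is_derive1_continuous (is_derive_poly p 1).
apply: (squeeze_cvgr _ (cvg_cst _) (onem_powR_cvg0 beta_gt0)).
near=> x; have x01 : x \in `]0, 1[.
  by rewrite in_itv /=; apply/andP; split; near: x;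
     [exact: nbhs_left_gt|exact: nbhs_left_lt].
by rewrite weight_le_powR_onem// ltW// weight_gt0.
Unshelve. all: by end_near. Qed.

Let horner_weight_cvg0_right p : p.[x] * w x @[x --> 0^'+] --> 0.
Proof.
rewrite -[X in _ --> X](mulr0 p.[0]); apply: cvgM.
  apply: cvg_at_right_filter.
  exact: is_derive1_continuous (is_derive_poly p 0).
apply: (squeeze_cvgr _ (cvg_cst _) (powR_cvg0 alpha_gt0)).
near=> x; have x01 : x \in `]0, 1[.
  by rewrite in_itv /=; apply/andP; split; near: x;
     [exact: nbhs_right_gt|exact: nbhs_right_lt].
by rewrite weight_le_powR// ltW// weight_gt0.
Unshelve. all: by end_near. Qed.

(** The derivative of [x q w] integrates to 0, as [x q w] vanishes at both ends. The summand [beta]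
    in [1 + alpha + beta] comes from [- beta x / (1 - x) = beta - beta / (1 - x)]. *)
Lemma moment_pearson q :
  (1 + alpha + beta) * moment w q + moment w ('X * q^`()) +
  t * moment (fun x => w x / x) q = beta * moment (fun x => w x / (1 - x)) q.
Proof.
have [iw iwx iw1] := And3 integrable_weight integrable_weight_div
  integrable_weight_div_onem.
(* The derivative is grouped by its singular factor into multiples of [w], [w / x] and
   [w / (1 - x)], each integrable by itself. *)
pose p1 := (1 + alpha + beta) *: q + 'X * q^`().
pose f1 x := p1.[x] * w x + (t *: q).[x] * (w x / x).
pose f x := f1 x + (- beta *: q).[x] * (w x / (1 - x)).
have if1 : mu.-integrable `]0, 1[ (EFin \o f1).
  exact: integrableD (integrable_horner p1 iw) (integrable_horner (t *: q) iwx).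
have i3 := integrable_horner (- beta *: q) iw1.
have f_int : mu.-integrable `]0, 1[ (EFin \o f) by exact: integrableD if1 i3.
have : \int[mu]_(x in `]0, 1[) f x = 0.
  rewrite /Rintegral
    (@integral_derive_oo R f (fun x => ('X * q).[x] * w x) 0 1 0 0)//.
  - by rewrite subrr.
  - move=> x x01; have [x0 x1] := itv01 x01.
    have dq := is_derive_poly ('X * q) x.
    have dw := is_derive_weight x01.
    have dF : is_derive x 1 (fun x => ('X * q).[x] * w x) _ := is_deriveM dq dw.
    apply: (is_derive_eq dF).
    rewrite /f /f1 /p1 derivM derivX mul1r /GRing.scale /=.
    rewrite !hornerD !hornerM !hornerZ hornerX.
    by field; rewrite !gt_eqF.
  - move=> x x01.
    have cp p : {for x, continuous (fun y => p.[y])}.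
      exact: is_derive1_continuous (is_derive_poly p x).
    apply: cvgD; first apply: cvgD; apply: cvgM => //; try exact: cp.
    + exact: continuous_weight.
    + exact: continuous_weight_div.
    + exact: continuous_weight_div_onem.
rewrite RintegralD//= RintegralD//=; last 2 first.
- exact: integrable_horner iw.
- exact: integrable_horner iwx.
have -> : moment w = moment_functional iw by [].
have -> : moment (fun x => w x / x) = moment_functional iwx by [].
have -> : moment (fun x => w x / (1 - x)) = moment_functional iw1 by [].
rewrite -[\int[mu]_(x in _) (p1.[x] * w x)]/(moment_functional iw p1).
rewrite -[\int[mu]_(x in _) (_ * (w x / x))]/(moment_functional iwx (t *: q)).
rewrite -[\int[mu]_(x in _) _]/(moment_functional iw1 (- beta *: q)).
rewrite /p1 linearD !linearZ /= => /eqP.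
by rewrite mulNr subr_eq0 => /eqP.
Qed.

End weight.

(** * The diagonal recurrence coefficient for the given weight *)

Theorem lemma3p1 (R : realType) (alpha beta t : R)
    (alpha_gt0 : 0 < alpha) (beta_gt0 : 0 < beta) (t_ge0 : 0 <= t)
    (P : nat -> {poly R}) (h a b : nat -> R)
    (P_orth : monic_orthogonal (weight alpha beta t) P h)
    (P_rec : three_term_recurrence P a b) (n : nat) :
  (2 * n%:R + 2 + alpha + beta) * a n =
    2 * (aux_rstar t (weight alpha beta t) P h n
         - aux_r beta (weight alpha beta t) P h n)
    + aux_R beta (weight alpha beta t) P h n - beta - t.
Proof.
set w := weight alpha beta t in P_orth *.
pose mu := @lebesgue_measure R.
have iw : mu.-integrable `]0, 1[ (EFin \o w) :=
  integrable_weight alpha_gt0 beta_gt0 t_ge0.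
have iwx : mu.-integrable `]0, 1[ (EFin \o (fun x => w x / x)) :=
  integrable_weight_div alpha_gt0 beta_gt0 t_ge0.
have iw1 : mu.-integrable `]0, 1[ (EFin \o (fun x => w x / (1 - x))) :=
  integrable_weight_div_onem alpha_gt0 beta_gt0 t_ge0.
have [P_monic {}P_orth] := P_orth.
have L_orth m k : moment_functional iw (P m * P k) = h k * (m == k)%:R.
  rewrite -P_orth; apply/esym/int01_moment => // x.
  by rewrite hornerM.
have P_neq0 k : P k != 0 by rewrite monic_neq0// (P_monic k).1.
have h_neq0 k : h k != 0.
  have := L_orth k k; rewrite eqxx mulr1 -expr2 => <-.
  apply: moment_neq0 => // x; exact: weight_gt0.
have P_size k : size (P k) = k.+1 := (P_monic k).2.
(* Coefficient [k] of the recurrence: [P k] contributes its leading 1, and the lower term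
   contributes nothing, having size at most [k]. *)
have a_coef k : ('X * P k - P k.+1)`_k = a k.
  have lead_P : (P k)`_k = 1.
    by have [/monicP + _] := P_monic k; rewrite lead_coefE P_size.
  rewrite P_rec.2 addrC !addrA addNr add0r coefD coefZ lead_P mulr1.
  case: k {lead_P} => [|k]; first by rewrite coef0 addr0.
  by rewrite coefZ (nth_default 0) ?P_size// mulr0 addr0.
have LxX p : moment_functional iwx ('X * p) = moment_functional iw p.
  apply: eq_Rintegral => x /[!inE] /= /[!in_itv]/= /andP[x0 _].
  by rewrite hornerM hornerX; field; rewrite gt_eqF.
have L1X p : moment_functional iw1 ('X * p) =
    moment_functional iw1 p - moment_functional iw p.
  (* Inside the interval [p w = (p - x p) w / (1 - x)], which reduces the claim to linearity of a
     single functional. *)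
  have -> : moment_functional iw p = moment_functional iw1 (p - 'X * p).
    apply: eq_Rintegral => x /[!inE] /= /[!in_itv]/= /andP[_ x1].
    by rewrite hornerD hornerN hornerM hornerX; field; rewrite subr_eq0 gt_eqF.
  by rewrite linearB; ring.
have pearson q : (1 + alpha + beta) * moment_functional iw q
    + moment_functional iw ('X * q^`()) + t * moment_functional iwx q =
    beta * moment_functional iw1 q.
  exact: moment_pearson.
have := recurrence_coef P_monic L_orth a_coef LxX L1X pearson n.
(* For [n = 0] both sides are 0, by the convention on [r_0] and by the index shift under ['X];
   otherwise this is [subleading_coef] divided by the nonzero norm. *)
have -> : aux_rstar t w P h n - aux_r beta w P h n = ('X * P n)`_n.
  rewrite coefXM; case: n => [|k] /=; first by rewrite subr0.
  apply: (mulIf (h_neq0 k)).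
  rewrite (subleading_coef P_monic L_orth pearson).
  rewrite (int01_moment (p := P k * P k.+1) iwx) => [|x]; last first.
    by rewrite hornerM [RHS]mulrA.
  rewrite (int01_moment (p := P k * P k.+1) iw1) => [|x]; last first.
    by rewrite hornerM [RHS]mulrA.
  by field.
have -> : aux_R beta w P h n = beta / h n * moment_functional iw1 (P n ^+ 2).
  rewrite /aux_R (int01_moment (p := P n ^+ 2) iw1)// => x.
  by rewrite horner_exp [RHS]mulrA.
move=> e; apply: (mulIf (h_neq0 n)); rewrite e.
by field.
Qed.
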